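(* If any two pairs of the three agents $A$ (Alice), $B$ (Bob) and $C$ (Charlie) share EPR pairs (say the state $(|00\rangle+|11\rangle)/\sqrt{2}$), then a GHZ state $(|000\rangle+|111\rangle)/\sqrt{2}$ can be prepared amongst them (one qubit with each agent), using local operations and two bits of classical communication, while involving all three agents dynamically.
   Context: The three agents are at separate nodes of a network. Two agents share an EPR pair if each holds one qubit of a two-qubit system in the state $(|00\rangle+|11\rangle)/\sqrt{2}$. Local operations are operations (adjoining ancilla qubits, unitaries, measurements) that an agent performs on the qubits it holds, possibly depending on classical bits received. Meaning of ''dynamically'': without loss of generality let $A$ be the agent sharing an EPR pair with each of the other two. Her first qubit $a1$ is paired with $B$'s qubit $b$, and her second qubit $a2$ is paired with $C$'s qubit $c$. $A$ prepares a third qubit $a3$ in the state $|0\rangle$ and locally entangles it with the first pair, obtaining $(|0_{a1}0_b0_{a3}\rangle+|1_{a1}1_b1_{a3}\rangle)/\sqrt{2}$. The state of the third qubit $a3$ is then to be transferred to $C$ by means of the EPR pair $(|0_{a2}0_c\rangle+|1_{a2}1_c\rangle)/\sqrt{2}$ and classical communication, so that the GHZ state $(|0_{a1}0_b0_c\rangle+|1_{a1}1_b1_c\rangle)/\sqrt{2}$ results. A party is dynamic (dynamically involved) if it is involved in applying the local operations for the completion of the transfer of the state of the third qubit to create the desired GHZ state. (Ordinary teleportation of $a3$ from $A$ to $C$ does not involve both $B$ and $C$ dynamically.) *)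

(* Defs.v *)
From HB Require Import structures.
From mathcomp Require Import all_boot all_order all_algebra.
From mathcomp Require Import reals complex.
Set Implicit Arguments.
Unset Strict Implicit.
Unset Printing Implicit Defensive.
Import Order.TTheory GRing.Theory Num.Theory.
Local Open Scope ring_scope.

Notation agent := 'I_3.

(* The classical memory of each agent: in chronological order, the outcomes of
   its own measurements and the bits it has received. *)
Definition memory := {ffun agent -> seq bool}.
Definition no_memory : memory := [ffun=> [::]].
Definition record (i : agent) (b : bool) (m : memory) : memory :=
  [ffun j => if j == i then rcons (m j) b else m j].

Section LOCC.

(* K plays the role of the field of complex numbers; [owner q] is the agent
   holding the qubit q of the register Q. *)
Variables (K : numClosedFieldType) (Q : finType) (owner : Q -> agent).

Definition state := {ffun {ffun Q -> bool} -> K}.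

Definition held (i : agent) := {q : Q | owner q == i}.

Definition restrict (i : agent) (x : {ffun Q -> bool}) : {ffun held i -> bool} :=
  [ffun q => x (val q)].

(* Matrices act on column vectors; the basis of the space of the qubits of i is
   {ffun held i -> bool}, numbered by enum_rank. *)
Definition local_unitary (i : agent) :=
  {u : 'M[K]_#|{ffun held i -> bool}| | u \is unitarymx}.

(* u (x) identity: only the coordinates of the qubits held by i change. *)
Definition apply_local (i : agent) (u : local_unitary i) (psi : state) : state :=
  [ffun x : {ffun Q -> bool} => \sum_(y : {ffun Q -> bool}
                     | [forall q, (owner q != i) ==> (y q == x q)])
     val u (enum_rank (restrict i x)) (enum_rank (restrict i y)) * psi y].

(* Not renormalised: the squared norm is the probability of the outcome. *)
Definition project (q : Q) (o : bool) (psi : state) : state :=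
  [ffun x : {ffun Q -> bool} => if x q == o then psi x else 0].

(* What an agent does may depend only on its own memory.  Measurements are in
   the computational basis, other bases being reached by a prior unitary.
   Adjoining an ancilla is rendered by a qubit of the register whose initial
   state is |0>. *)
Inductive step :=
| Unitary (i : agent) of seq bool -> local_unitary i
| Measure of Q
| Send (i j : agent) of i != j & (seq bool -> bool).

Definition protocol := seq step.

(* Unnormalised outcome of the steps already performed. *)
Definition branch := (memory * state)%type.

Definition run_step (s : step) (br : branch) : seq branch :=
  let: (m, psi) := br in
  match s with
  | Unitary i u => [:: (m, apply_local (u (m i)) psi)]
  | Measure q => [seq (record (owner q) o m, project q o psi)
                 | o <- [:: false; true]]
  | Send i j _ f => [:: (record j (f (m i)) m, psi)]
  end.

Fixpoint run (p : protocol) (br : branch) : seq branch :=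
  if p is s :: p' then flatten [seq run p' br' | br' <- run_step s br]
  else [:: br].

Definition bits_sent (p : protocol) : nat :=
  count (fun s => if s is Send _ _ _ _ then true else false) p.

Definition local_op_of (i : agent) (s : step) : bool :=
  match s with
  | Unitary j _ => j == i
  | Measure q => owner q == i
  | Send _ _ _ _ => false
  end.

Definition prepares (goal : state -> Prop) (p : protocol) (psi : state) : Prop :=
  forall br, br \in run p (no_memory, psi) -> br.2 != 0 -> goal br.2.

Definition without (i : agent) (p : protocol) : protocol :=
  [seq s <- p | ~~ local_op_of i s].

(* i takes part in the local operations, and the goal is not reached when
   exactly the local operations of i are left out; idle or mutually cancelling
   operations do not make an agent dynamic. *)
Definition dynamic (goal : state -> Prop) (p : protocol) (psi : state)
    (i : agent) : Prop :=
  has (local_op_of i) p /\ ~ prepares goal (without i p) psi.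

End LOCC.

Section GHZ.

Variable K : numClosedFieldType.

Definition epr (t : 2.-tuple bool) : K :=
  ((t == [tuple false; false])%:R + (t == [tuple true; true])%:R) / sqrtC 2.

Definition ghz (t : 3.-tuple bool) : K :=
  ((t == [tuple false; false; false])%:R + (t == [tuple true; true; true])%:R)
    / sqrtC 2.

Notation qubit := 'I_5.

Definition a1 : qubit := @Ordinal 5 0 isT.
Definition b  : qubit := @Ordinal 5 1 isT.
Definition a2 : qubit := @Ordinal 5 2 isT.
Definition c  : qubit := @Ordinal 5 3 isT.
Definition a3 : qubit := @Ordinal 5 4 isT.

Definition owner_of (A B C : agent) : qubit -> agent :=
  tnth [tuple A; B; A; C; A].

Definition shared_pairs : state K qubit :=
  [ffun x : {ffun qubit -> bool} =>
     epr [tuple x a1; x b] * epr [tuple x a2; x c] * (x a3 == false)%:R].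

Definition entangled_third : state K qubit :=
  [ffun x : {ffun qubit -> bool} =>
     ghz [tuple x a1; x b; x a3] * epr [tuple x a2; x c]].

(* The GHZ state on a1, b, c, in tensor product with an arbitrary state of the
   other two qubits; phi also absorbs the missing normalisation. *)
Definition ghz_shared (psi : state K qubit) : Prop :=
  exists phi : bool -> bool -> K, forall x : {ffun qubit -> bool},
    psi x = ghz [tuple x a1; x b; x c] * phi (x a2) (x a3).

End GHZ.

(* Main.v *)
(** The third qubit a3 is first attached to C's qubit instead of being teleported:
    the parity of a2 and a3 is measured (CNOT from a3 to a2, then a2 is measured),
    and C flips c when the outcome is 1, which yields a four-qubit GHZ state on
    a1, b, a3, c.  A then erases a3 by measuring it in the Hadamard basis; this
    leaves the GHZ state on a1, b, c up to a relative sign given by the outcome,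
    which any holder of a share can correct.  The second bit is sent to B, who
    applies a phase flip.  Leaving out the operations of one agent leaves a branch
    with an uncorrected bit flip (C) or sign (B), or c unrelated to a1 (A). *)

Require Import Defs.
From mathcomp Require Import all_boot all_order all_algebra.
From mathcomp Require Import reals complex.
From mathcomp Require Import ring.
Import GRing.Theory Num.Theory.
Set Implicit Arguments.
Unset Strict Implicit.
Unset Printing Implicit Defensive.
Local Open Scope ring_scope.

(** * Bit strings that differ in at most one position *)

Definition set_bit (T : finType) (q : T) (o : bool) (x : {ffun T -> bool}) :
    {ffun T -> bool} :=
  [ffun r => if r == q then o else x r].

Definition agree_off (T : finType) (q : T) (x y : {ffun T -> bool}) : bool :=
  [forall r, (r != q) ==> (y r == x r)].

Lemma agree_offP (T : finType) (q : T) (x y : {ffun T -> bool}) :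
  reflect (y = set_bit q (y q) x) (agree_off q x y).
Proof.
apply: (iffP forallP) => [xy | -> r].
  apply/ffunP => r; rewrite ffunE; case: eqP => [-> // | /eqP rq].
  by apply/eqP; have := xy r; rewrite rq.
by apply/implyP => /negbTE rq; rewrite ffunE rq.
Qed.

Lemma set_bit_at (T : finType) (q : T) o (x : {ffun T -> bool}) :
  set_bit q o x q = o.
Proof. by rewrite ffunE eqxx. Qed.

Lemma set_bit_id (T : finType) (q : T) (x : {ffun T -> bool}) :
  set_bit q (x q) x = x.
Proof. by apply/ffunP => r; rewrite ffunE; case: eqP => [->|]. Qed.

Lemma agree_off_set (T : finType) (q : T) o (x : {ffun T -> bool}) :
  agree_off q x (set_bit q o x).
Proof. by apply/agree_offP; rewrite set_bit_at. Qed.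

Lemma agree_off_setr (T : finType) (q : T) o (x y : {ffun T -> bool}) :
  agree_off q x (set_bit q o y) = agree_off q x y.
Proof. by apply: eq_forallb => r; rewrite ffunE; case: (r == q). Qed.

Lemma sum_agree_off (K : nmodType) (T : finType) (q : T) (x : {ffun T -> bool})
    (F : {ffun T -> bool} -> K) :
  \sum_(y | agree_off q x y) F y = F (set_bit q false x) + F (set_bit q true x).
Proof.
rewrite (bigD1 (set_bit q false x)) ?agree_off_set //=; congr (_ + _).
apply: big_pred1 => y; apply/andP/eqP => [[/agree_offP-> ] | ->].
  by case: (y q) => //; rewrite eqxx.
split; first exact: agree_off_set.
by apply/eqP => /ffunP/(_ q); rewrite !set_bit_at.
Qed.

(** * Gates acting on one qubit, possibly controlled by others *)

Definition one_qubit_matrix (K : numClosedFieldType) (T : finType) (q : T)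
    (w : {ffun T -> bool} -> bool -> bool -> K) :
    'M[K]_#|{ffun T -> bool}| :=
  \matrix_(i, j) (let x := enum_val i in let y := enum_val j in
                  if agree_off q x y then w x (x q) (y q) else 0).

(* The matrix [w x] acts on qubit q and may be controlled by the other qubits of x,
   hence the first condition. *)
Definition unitary_gate (K : numClosedFieldType) (T : finType) (q : T)
    (w : {ffun T -> bool} -> bool -> bool -> K) : Prop :=
  (forall x o, w (set_bit q o x) = w x) /\
  forall x o o', w x o false * (w x o' false)^* + w x o true * (w x o' true)^*
                 = (o == o')%:R.

(** Row [x] is supported on the two strings that agree with [x] off [q]. Two rows whose indices
    differ elsewhere have disjoint supports; otherwise they use the same [w], and the condition on 2
    by 2 matrices applies. *)
Lemma one_qubit_matrix_unitary (K : numClosedFieldType) (T : finType) (q : T)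
    (w : {ffun T -> bool} -> bool -> bool -> K) :
  unitary_gate q w -> one_qubit_matrix q w \is unitarymx.
Proof.
move=> [wq wU]; apply/unitarymxP/matrixP => i j; rewrite !mxE.
under eq_bigr => k _ do rewrite !mxE.
rewrite (reindex enum_rank) /=; last exact/onW_bij/enum_rank_bij.
under eq_bigr => y _ do rewrite enum_rankK.
rewrite -(inj_eq enum_val_inj); move: (enum_val i) (enum_val j) => x z {i j}.
rewrite (eq_bigr (fun y => if agree_off q x y then
  w x (x q) (y q) * (if agree_off q z y then w z (z q) (y q) else 0)^* else 0));
  last by move=> y _; case: ifP; rewrite ?mul0r.
rewrite -big_mkcond sum_agree_off /= !set_bit_at !agree_off_setr.
have [/agree_offP-> | xz] := boolP (agree_off q z x); last first.
  rewrite conjC0 !mulr0 addr0; case: eqP xz => // ->.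
  by rewrite -{2}[z](set_bit_id q) agree_off_set.
rewrite set_bit_at wq wU; congr (nat_of_bool _)%:R.
by apply/eqP/eqP => [-> | xz]; rewrite ?set_bit_id // -xz set_bit_at.
Qed.

Definition gate (K : numClosedFieldType) (Q : finType) (owner : Q -> agent)
    (i : agent) (q : held owner i) w (wU : unitary_gate q w) :
    local_unitary K owner i :=
  exist _ (one_qubit_matrix q w) (one_qubit_matrix_unitary wU).

(** Agreement off the qubits of [i] and, among these, off [q] amounts to agreement off [val q], so
    the sum in [apply_local] keeps two terms. *)
Lemma apply_gate (K : numClosedFieldType) (Q : finType) (owner : Q -> agent)
    (i : agent) (q : held owner i) w (wU : unitary_gate q w)
    (psi : state K Q) x :
  apply_local (gate wU) psi x
  = w (Defs.restrict owner i x) (x (val q)) false * psi (set_bit (val q) false x)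
  + w (Defs.restrict owner i x) (x (val q)) true * psi (set_bit (val q) true x).
Proof.
rewrite ffunE /=.
under eq_bigr => y _ do rewrite !mxE !enum_rankK.
rewrite (eq_bigr (fun y =>
  if agree_off q (Defs.restrict owner i x) (Defs.restrict owner i y)
  then w (Defs.restrict owner i x) (x (val q)) (y (val q)) * psi y else 0)); last first.
  by move=> y _ /=; case: ifP; rewrite ?mul0r // !ffunE.
rewrite -big_mkcondr.
rewrite (eq_bigl (agree_off (val q) x)) => [|y]; last first.
  apply/andP/forallP => [[/forallP xy /forallP xy'] r | xy].
    apply/implyP => rq; have [ri | ri] := boolP (owner r == i).
      by have := xy' (exist _ r ri); rewrite !ffunE /= -val_eqE /= rq.
    by have := xy r; rewrite ri.
  split; apply/forallP => r; apply/implyP => rq.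
    by have := xy r; case: (r =P val q) rq => //= ->; rewrite (valP q).
  by rewrite !ffunE; have := xy (val r); rewrite val_eqE rq.
by rewrite sum_agree_off !set_bit_at.
Qed.

(** * The CNOT, NOT, phase and Hadamard gates *)

Definition xor_entry (K : numClosedFieldType) (T : finType)
    (ctl : {ffun T -> bool} -> bool) x (o o' : bool) : K :=
  (o == o' (+) ctl x)%:R.

(** The Pauli gate Z raised to the power [s]. *)
Definition phase_entry (K : numClosedFieldType) (T : finType) (s : bool)
    (x : {ffun T -> bool}) (o o' : bool) : K :=
  (o == o')%:R * (-1) ^+ (s && o).

Definition hadamard_entry (K : numClosedFieldType) (T : finType)
    (x : {ffun T -> bool}) (o o' : bool) : K :=
  (-1) ^+ (o && o') / sqrtC 2.

Lemma xor_unitary (K : numClosedFieldType) (T : finType) (q : T)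
    (ctl : {ffun T -> bool} -> bool) :
  (forall x o, ctl (set_bit q o x) = ctl x) ->
  unitary_gate q (@xor_entry K T ctl).
Proof.
move=> ctlq; split=> [x o | x o o']; first by rewrite /xor_entry ctlq.
rewrite /xor_entry !conjC_nat.
by case: (ctl x) o o' => [] [] [] /=; rewrite !(mul0r, mulr0, mulr1, addr0, add0r).
Qed.

Lemma phase_unitary (K : numClosedFieldType) (T : finType) (q : T) s :
  unitary_gate q (@phase_entry K T s).
Proof.
split=> // x o o'; rewrite /phase_entry !rmorphM !rmorph_sign !rmorph_nat.
by case: s o o' => [] [] [] /=; rewrite ?expr1 ?expr0; ring.
Qed.

Lemma hadamard_unitary (K : numClosedFieldType) (T : finType) (q : T) :
  unitary_gate q (@hadamard_entry K T).
Proof.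
split=> // x o o'.
have real_entry p p' : (hadamard_entry K x p p')^* = hadamard_entry K x p p'.
  rewrite conj_Creal // rpredM ?rpredX ?rpredN ?rpred1 // rpredV.
  by rewrite ger0_real // sqrtC_ge0 ler0n.
have two_neq0 : (2 : K) != 0 by rewrite pnatr_eq0.
(* To [field], [sqrtC 2] is an atom, so its square is evaluated beforehand. *)
have hh : (sqrtC 2)^-1 * (sqrtC 2)^-1 = 2^-1 :> K.
  by rewrite -invfM -expr2 sqrtCK.
rewrite !real_entry /hadamard_entry.
rewrite [X in X + _]mulrACA [X in _ + X]mulrACA hh.
by case: o o' => [] [] /=; rewrite ?expr1 ?expr0; field.
Qed.

Lemma cnot_unitary (K : numClosedFieldType) (T : finType) (q r : T) :
  r != q -> unitary_gate q (@xor_entry K T (fun x => x r)).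
Proof. by move=> /negbTE rq; apply: xor_unitary => x o; rewrite ffunE rq. Qed.

Lemma not_unitary (K : numClosedFieldType) (T : finType) (q : T) s :
  unitary_gate q (@xor_entry K T (fun=> s)).
Proof. exact: xor_unitary. Qed.

(** * Amplitudes of the shared states, and outcomes of runs *)

Lemma eprE (K : numClosedFieldType) p q :
  epr K [tuple p; q] = (p == q)%:R / sqrtC 2.
Proof.
by rewrite /epr -!val_eqE; case: p q => [] [] /=; rewrite ?addr0 ?add0r.
Qed.

Lemma ghzE (K : numClosedFieldType) p q r :
  ghz K [tuple p; q; r] = ((p == q) && (q == r))%:R / sqrtC 2.
Proof.
by rewrite /ghz -!val_eqE; case: p q r => [] [] [] /=; rewrite ?addr0 ?add0r.
Qed.

Lemma last_record i o m : last false (record i o m i) = o.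
Proof. by rewrite ffunE eqxx last_rcons. Qed.

Lemma run_cat (K : numClosedFieldType) (Q : finType) (owner : Q -> agent)
    (p p' : protocol K owner) br :
  run (p ++ p') br = flatten [seq run p' br' | br' <- run p br].
Proof.
elim: p br => [|s p IHp] br; first by rewrite /= cats0.
rewrite /=; elim: (run_step s br) => //= br' brs ->.
by rewrite IHp map_cat flatten_cat.
Qed.

(** The goal concerns states only; dropping the final memories makes the list of branches short to
    state. *)
Definition outcomes (K : numClosedFieldType) (Q : finType) (owner : Q -> agent)
    (p : protocol K owner) (psi : state K Q) : seq (state K Q) :=
  [seq br.2 | br <- run p (no_memory, psi)].

Lemma prepares_outcomes (K : numClosedFieldType) (Q : finType)
    (owner : Q -> agent) goal (p : protocol K owner) (psi : state K Q) :
  prepares goal p psi <->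
  forall phi, phi \in outcomes p psi -> phi != 0 -> goal phi.
Proof.
split=> [good phi /mapP[br br_run ->] | good br br_run]; first exact: good.
by apply: good; apply: map_f.
Qed.

(** * The protocol and the states it passes through *)

Section GHZFromTwoEPRPairs.

Variables (K : numClosedFieldType) (A B C : agent).

Let owner := owner_of A B C.

Definition held_a1 : held owner A := exist _ a1 (eqxx A).
Definition held_a2 : held owner A := exist _ a2 (eqxx A).
Definition held_a3 : held owner A := exist _ a3 (eqxx A).
Definition held_b : held owner B := exist _ b (eqxx B).
Definition held_c : held owner C := exist _ c (eqxx C).

Definition cnot_a1_a3 := gate (@cnot_unitary K _ held_a3 held_a1 isT).
Definition cnot_a3_a2 := gate (@cnot_unitary K _ held_a2 held_a3 isT).
Definition hadamard_a3 := gate (@hadamard_unitary K _ held_a3).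
Definition flip_c (s : bool) := gate (@not_unitary K _ held_c s).
Definition phase_b (s : bool) := gate (@phase_unitary K _ held_b s).

Definition prep_protocol : protocol K owner := [:: Unitary (fun=> cnot_a1_a3)].

Definition transfer_protocol (neq_AB : A != B) (neq_AC : A != C) :
    protocol K owner :=
  [:: Unitary (fun=> cnot_a3_a2);
      Measure K owner a2;
      Send K owner neq_AC (last false);
      Unitary (fun m => flip_c (last false m));
      Unitary (fun=> hadamard_a3);
      Measure K owner a3;
      Send K owner neq_AB (last false);
      Unitary (fun m => phase_b (last false m))].

Lemma run_prep :
  run prep_protocol (no_memory, shared_pairs K)
  = [:: (no_memory, entangled_third K)].
Proof.
congr [:: (_, _)]; apply/ffunP => x; rewrite apply_gate !ffunE /= !eprE ghzE.
rewrite /xor_entry !ffunE /=.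
by case: (x a3) (x a1) (x b) => [] [] [] /=; ring.
Qed.

(* Reached once a2 has been measured; [e] is the bit flip pending on c. *)
Definition after_a2 (s e : bool) : state K 'I_5 :=
  [ffun x : {ffun 'I_5 -> bool} =>
     [&& x a2 == s, x a1 == x b, x b == x a3 & x c == x a3 (+) e]%:R
       / sqrtC 2 / sqrtC 2].

(* Reached once a3 has been measured too; [u] is the phase flip pending on b. *)
Definition after_a3 (s t e u : bool) : state K 'I_5 :=
  [ffun x : {ffun 'I_5 -> bool} =>
     [&& x a2 == s, x a3 == t, x a1 == x b & x c == x b (+) e]%:R
       * (-1) ^+ (u && x b) / sqrtC 2 / sqrtC 2 / sqrtC 2].

(** Reading [s] after the CNOT means that [a2] was [a3 (+) s] before it. Since [c] equals the old
    [a2], a flip by [s] is pending on [c]. *)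
Lemma measure_a2 s :
  project a2 s (apply_local cnot_a3_a2 (entangled_third K)) = after_a2 s s.
Proof.
apply/ffunP => x; rewrite ffunE apply_gate !ffunE !ghzE !eprE.
rewrite /xor_entry !ffunE /=; move: (x a1) (x b) (x a2) (x c) (x a3).
by case: s => [] [] [] [] [] [] /=; ring.
Qed.

Lemma apply_flip_c r s e :
  apply_local (flip_c r) (after_a2 s e) = after_a2 s (e (+) r).
Proof.
apply/ffunP => x; rewrite apply_gate !ffunE /xor_entry /=.
move: (x a1 == x b) (x b == x a3) (x a2 == s) (x c) (x a3) => [] [] [] [] [];
  by case: r e => [] [] /=; ring.
Qed.

(** The Hadamard gate contributes a sign that is -1 when [t] and the old [a3] are both 1. Since the
    old [a3] equals [b], this sign can be corrected at [b]. *)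
Lemma measure_a3 s t e :
  project a3 t (apply_local hadamard_a3 (after_a2 s e)) = after_a3 s t e t.
Proof.
apply/ffunP => x; rewrite ffunE apply_gate !ffunE /hadamard_entry /=.
move: (x a1) (x b) (x a2 == s) (x c) (x a3) => [] [] [] [] [];
  by case: t e => [] [] /=; ring.
Qed.

Lemma apply_phase_b r s t e u :
  apply_local (phase_b r) (after_a3 s t e u) = after_a3 s t e (u (+) r).
Proof.
apply/ffunP => x; rewrite apply_gate !ffunE /phase_entry /=.
move: (x a1) (x b) (x a2 == s) (x c) (x a3 == t) => [] [] [] [] [];
  by case: r u e => [] [] [] /=; ring.
Qed.

Lemma apply_flip_c_id psi : apply_local (flip_c false) psi = psi.
Proof.
apply/ffunP => x; rewrite apply_gate /xor_entry /= -[in RHS](set_bit_id c x).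
by case: (x c) => /=; ring.
Qed.

Lemma apply_phase_b_id psi : apply_local (phase_b false) psi = psi.
Proof.
apply/ffunP => x; rewrite apply_gate /phase_entry /= -[in RHS](set_bit_id b x).
by case: (x b) => /=; ring.
Qed.

(** * Tests that refute a shared GHZ state *)

Definition basis_state (p1 p2 p3 p4 p5 : bool) : {ffun 'I_5 -> bool} :=
  [ffun q : 'I_5 => nth false [:: p1; p2; p3; p4; p5] q].

(** Detects a [c] that is not tied to [a1] and [b]: the arguments of [basis_state] are in the order
    [a1], [b], [a2], [c], [a3]. *)
Lemma ghz_shared_outside (psi : state K 'I_5) p q :
  ghz_shared psi -> psi (basis_state false false p true q) = 0.
Proof. by case=> phi ->; rewrite !ffunE /= ghzE !mul0r. Qed.

(** Detects a wrong relative sign, since [phi] sees only [a2] and [a3]. *)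
Lemma ghz_shared_symmetric (psi : state K 'I_5) p q :
  ghz_shared psi ->
  psi (basis_state false false p false q) = psi (basis_state true true p true q).
Proof. by case=> phi psiE; rewrite !psiE !ffunE /= !ghzE. Qed.

Lemma neq0_at (psi : state K 'I_5) x : psi x != 0 -> psi != 0.
Proof. by apply: contra_neq => ->; rewrite ffunE. Qed.

Lemma sqrt2_neq0 : sqrtC (2 : K) != 0.
Proof. by rewrite sqrtC_eq0 pnatr_eq0. Qed.

Lemma after_a3_ghz s t : ghz_shared (after_a3 s t false false).
Proof.
exists (fun p q => ((p == s) && (q == t))%:R / sqrtC 2 / sqrtC 2) => x.
rewrite ffunE ghzE addbF (eq_sym (x c)).
by case: (x a2 == s) (x a3 == t) (x a1 == x b) (x b == x c)
  => [] [] [] [] /=; ring.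
Qed.

Lemma after_a3_unflipped s t : ~ ghz_shared (after_a3 s t true false).
Proof.
move=> /(ghz_shared_outside s t)/eqP; rewrite !ffunE /= !eqxx mulr1 /=.
by rewrite !mulf_eq0 !invr_eq0 (negbTE sqrt2_neq0) oner_eq0.
Qed.

Lemma after_a3_unphased s t : ~ ghz_shared (after_a3 s t false true).
Proof.
move=> /(ghz_shared_symmetric s t)/eqP; rewrite !ffunE /= !eqxx /=.
rewrite -subr_eq0 -!mulrBl !mulf_eq0 !invr_eq0 (negbTE sqrt2_neq0) !orbF.
by rewrite expr0 expr1 !mul1r opprK -[1 + 1]/(2%:R) pnatr_eq0.
Qed.

(** Since [prepares] ignores zero branches, a failing branch refutes it only if it is nonzero. *)
Lemma after_a3_neq0 s t e u : after_a3 s t e u != 0.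
Proof.
apply: (@neq0_at _ (basis_state false false s e t)).
rewrite !ffunE /= !eqxx andbF mulr1 /=.
by rewrite !mulf_neq0 ?invr_neq0 ?sqrt2_neq0 ?oner_neq0.
Qed.

(** * Runs of the transfer, complete or without one agent *)

Hypotheses (neq_AB : A != B) (neq_AC : A != C) (neq_BC : B != C).

Let transfer := transfer_protocol neq_AB neq_AC.

Lemma outcomes_transfer psi :
  outcomes transfer psi =
  [seq apply_local (phase_b t)
     (project a3 t (apply_local hadamard_a3 (apply_local (flip_c s)
       (project a2 s (apply_local cnot_a3_a2 psi)))))
  | s <- [:: false; true], t <- [:: false; true]].
Proof. by rewrite /outcomes /= !last_record. Qed.

Let neqs := (negbTE neq_AB, negbTE neq_AC, negbTE neq_BC,
  eq_sym B A, eq_sym C A, eq_sym C B).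

(** Without measurements the memory of [A] stays empty, so both messages are the default [false] of
    [last] and neither correction does anything. *)
Lemma outcomes_without_A psi :
  outcomes (without A transfer) psi
  = [:: apply_local (phase_b false) (apply_local (flip_c false) psi)].
Proof.
rewrite /without /= !eqxx !neqs /outcomes /= !last_record.
by rewrite !ffunE !neqs.
Qed.

Lemma outcomes_without_B psi :
  outcomes (without B transfer) psi =
  [seq project a3 t (apply_local hadamard_a3 (apply_local (flip_c s)
       (project a2 s (apply_local cnot_a3_a2 psi))))
  | s <- [:: false; true], t <- [:: false; true]].
Proof. by rewrite /without /= !eqxx !neqs /outcomes /= !last_record. Qed.

Lemma outcomes_without_C psi :
  outcomes (without C transfer) psi =
  [seq apply_local (phase_b t)
     (project a3 t (apply_local hadamard_a3
       (project a2 s (apply_local cnot_a3_a2 psi))))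
  | s <- [:: false; true], t <- [:: false; true]].
Proof. by rewrite /without /= !eqxx !neqs /outcomes /= !last_record. Qed.

Lemma prepares_ghz :
  prepares (@ghz_shared K) (prep_protocol ++ transfer) (shared_pairs K).
Proof.
move=> br; rewrite run_cat run_prep [flatten _](cats0 (run transfer _)) => br_run _.
have : br.2 \in outcomes transfer (entangled_third K) by apply: map_f.
rewrite outcomes_transfer => /allpairsP[[s t] [_ _ ->]] /=.
(* Each received bit equals the pending one, so [addbb] clears both. *)
rewrite measure_a2 apply_flip_c measure_a3 apply_phase_b !addbb.
exact: after_a3_ghz.
Qed.

Lemma dynamic_A : dynamic (@ghz_shared K) transfer (entangled_third K) A.
Proof.
split; first by rewrite /= eqxx.
rewrite prepares_outcomes outcomes_without_A apply_flip_c_id apply_phase_b_id.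
(* The two pairs are still independent, so [a1] and [b] can be 0 while [a2] and [c] are 1. *)
have amplitude_neq0 :
    entangled_third K (basis_state false false true true false) != 0.
  by rewrite !ffunE /= ghzE eprE !mul1r mulf_neq0 ?invr_neq0 ?sqrt2_neq0.
move=> /(_ _ (mem_head _ _) (neq0_at amplitude_neq0)).
by move=> /(ghz_shared_outside true false)/eqP; apply/negP.
Qed.

Lemma dynamic_B : dynamic (@ghz_shared K) transfer (entangled_third K) B.
Proof.
split; first by rewrite /= eqxx !orbT.
rewrite prepares_outcomes outcomes_without_B => good.
apply: (@after_a3_unphased false true); apply: good (after_a3_neq0 _ _ _ _).
(* In this branch no bit flip is needed, and the missing phase is the only defect. *)
apply/allpairsP; exists (false, true); split=> //=.
by rewrite measure_a2 apply_flip_c measure_a3.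
Qed.

Lemma dynamic_C : dynamic (@ghz_shared K) transfer (entangled_third K) C.
Proof.
split; first by rewrite /= eqxx !orbT.
rewrite prepares_outcomes outcomes_without_C => good.
apply: (@after_a3_unflipped true false); apply: good (after_a3_neq0 _ _ _ _).
(* Here no phase flip is needed, and the missing bit flip is the only defect. *)
apply/allpairsP; exists (true, false); split=> //=.
by rewrite measure_a2 measure_a3 apply_phase_b.
Qed.

End GHZFromTwoEPRPairs.

(** * Naming the agents, and the final statement *)

Lemma two_pairs_share_agent (P1 P2 : {set agent}) :
  #|P1| = 2%N -> #|P2| = 2%N -> P1 != P2 ->
  exists A B C : agent,
    [/\ uniq [:: A; B; C], P1 = [set A; B] & P2 = [set A; C]].
Proof.
move=> /eqP/cards2P[x [y [xy ->]]] /eqP/cards2P[z [w [zw ->]]] neq.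
have uniq3 (u v t : agent) : u != v -> u != t ->
    [set u; v] != [set u; t] -> uniq [:: u; v; t].
  move=> uv ut vt; rewrite /= !inE negb_or uv ut /= andbT.
  by apply: contraNneq vt => ->.
have [xz | xz] := eqVneq x z; first by subst z; exists x, y, w; rewrite uniq3.
have [xw | xw] := eqVneq x w.
  by subst w; exists x, y, z; rewrite uniq3 ?(setUC [set x] [set z]) // eq_sym.
have [yz | yz] := eqVneq y z.
  by subst z; exists y, x, w; rewrite uniq3 ?(setUC [set y] [set x]) // eq_sym.
have [yw | yw] := eqVneq y w.
  subst w; exists y, x, z.
  by rewrite uniq3 ?(setUC [set y]) // eq_sym.
(* Disjoint pairs would require four distinct agents, but there are three. *)
have /card_uniqP/= card4 : uniq [:: x; y; z; w].
  by rewrite /= !inE !negb_or xy xz xw yz yw zw.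
by have := max_card (mem [:: x; y; z; w]); rewrite card4 card_ord.
Qed.

Lemma uniq_agents (A B C i : agent) : uniq [:: A; B; C] -> i \in [:: A; B; C].
Proof.
move=> uABC; have card_eq : #|[:: A; B; C]| = #|agent|.
  by rewrite (card_uniqP uABC) card_ord.
by have /subset_cardP/(_ (subset_predT _))-> := card_eq.
Qed.

Theorem theorem2p1 (R : realType) (P1 P2 : {set agent})
    (card_P1 : #|P1| = 2%N) (card_P2 : #|P2| = 2%N) (P1_neq_P2 : P1 != P2) :
  exists A B C : agent,
    [/\ uniq [:: A; B; C], P1 = [set A; B], P2 = [set A; C] &
     exists prep transfer : protocol R[i] (owner_of A B C),
       [/\ all (local_op_of A) prep,
           run prep (no_memory, shared_pairs R[i])
             = [:: (no_memory, entangled_third R[i])],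
           prepares (@ghz_shared R[i]) (prep ++ transfer) (shared_pairs R[i]),
           bits_sent (prep ++ transfer) = 2%N &
           forall i : agent,
             dynamic (@ghz_shared R[i]) transfer (entangled_third R[i]) i]].
Proof.
have [A [B [C [uABC -> ->]]]] := two_pairs_share_agent card_P1 card_P2 P1_neq_P2.
exists A, B, C; split=> //.
have /and3P[neq_AB neq_AC neq_BC] : [&& A != B, A != C & B != C].
  by move: uABC; rewrite /= !inE negb_or andbT -andbA.
exists (prep_protocol _ A B C), (transfer_protocol _ neq_AB neq_AC); split.
- by rewrite /= eqxx.
- exact: run_prep.
- exact: prepares_ghz.
- by [].
move=> i; have := uniq_agents i uABC; rewrite !inE => /or3P[] /eqP->.
- exact: dynamic_A.
- exact: dynamic_B.
- exact: dynamic_C.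
Qed.
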